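(* Let $X$ be a finite alphabet with at least two letters, let $\mathsf{A}$ be a polynomial automaton of degree $m$ over $X$, and let $G$ be the automaton group generated by $\mathsf{A}$. There exists a constant $A$ such that every orbital Schreier graph $\Gamma_w(G)$, $w\in X^{\omega}$, has subexponential growth, and its growth is not greater than $A^{(\log n)^{m+1}}$.
   Context: Automata. $X^{*}$ is the set of finite words over $X$ (including the empty word) and $X^{\omega}$ is the set of right-infinite sequences over $X$. An (invertible) automaton over $X$ consists of a set of states $S$, a transition function $\lambda:S\times X\to S$ and an output function $\pi:S\times X\to X$ such that $\pi(s,\cdot)$ is a permutation of $X$ for every $s\in S$. It is viewed as a directed labeled graph with vertex set $S$ and, for every $s\in S$ and $x\in X$, an arrow $s\to\lambda(s,x)$ labeled $x|\pi(s,x)$ (different letters give different arrows). Each state $s$ acts on $X^{*}\cup X^{\omega}$: $s(xv)=\pi(s,x)\,\lambda(s,x)(v)$ for $x\in X$, $v\in X^*\cup X^\omega$. This action is invertible. All automata are assumed minimized: different states act differently on $X^{\omega}$, and states are identified with the corresponding transformations of $X^{\omega}$. The automaton group generated by $\mathsf A$ is the group of transformations of $X^{\omega}$ generated by all states of $\mathsf A$. The trivial state, denoted $e$, is the state acting trivially on $X^{\omega}$. Polynomial automata. A cycle means a simple directed cycle (loops included). A cycle is trivial if it is a loop at $e$. A finite automaton is polynomial if different nontrivial cycles in it are disjoint (share no vertex). A polynomial automaton has degree $m$ (an integer $m\ge -1$) if the largest number of nontrivial cycles connected by a directed path (i.e. different nontrivial cycles met by one directed path) equals $m+1$. Schreier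 graphs. For a finite generating set $S$ of $G$, $\Gamma_w(G)=\Gamma_w(G,S)$ is the graph with vertex set the orbit $G(w)$, in which $u,v$ are adjacent iff $s(v)=u$ for some $s\in S\cup S^{-1}$. Its growth does not depend on the choice of $S$. Growth. The growth function $\gamma_v(n)$ of a connected locally finite graph with respect to a vertex $v$ is the number of vertices in the closed ball of radius $n$ centered at $v$. A function $f$ has growth not greater than $g$ (written $f\prec g$) if there is a constant $C>0$ with $f(n)\le g(Cn)$ for all $n\in\mathbb N$; $f\sim g$ (equivalent) if $f\prec g$ and $g\prec f$. The growth functions with respect to different vertices are equivalent, so one speaks of the growth of the graph. A graph has subexponential growth if its growth function has growth not greater than $a^n$ ($a>1$) and is not equivalent to it. Logarithms are to base $2$, with the convention $\log 0=\log 1=1$. *)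

(* Defs.v *)
From HB Require Import structures.
From mathcomp Require Import all_boot all_order all_algebra perm.
From mathcomp Require Import finmap.
From mathcomp Require Import all_classical all_reals all_analysis.

Set Implicit Arguments.
Unset Strict Implicit.
Unset Printing Implicit Defensive.

Import Order.TTheory GRing.Theory Num.Theory.

Local Open Scope classical_set_scope.
Local Open Scope ring_scope.

(** * Automata *)

Record automaton (X S : finType) := Automaton {
  trans : S -> X -> S ;
  out : S -> {perm X} }.

(** Right-infinite sequences over [X] are functions [nat -> X]; a
    transformation is an arbitrary self-map of [nat -> X]. *)
Definition transf (X : finType) := (nat -> X) -> (nat -> X).

(** [act M s w] is the sequence [s(w)], that is,
    [s(x v) = out s x, followed by (trans s x)(v)]. *)
Fixpoint act (X S : finType) (M : automaton X S) (s : S) (w : nat -> X)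
    (n : nat) {struct n} : X :=
  if n is n'.+1 then act M (trans M s (w 0%N)) (fun k => w k.+1) n'
  else out M s (w 0%N).

Definition minimized (X S : finType) (M : automaton X S) : Prop :=
  injective (act M : S -> transf X).

Definition trivial_state (X S : finType) (M : automaton X S) (s : S) : Prop :=
  forall w, act M s w = w.

(** * Polynomial automata *)

(** The graph of an automaton is a multigraph: its arrows are the pairs
    [(s, x)], from [s] to [trans M s x], so that different letters give
    different arrows.  A simple cycle, regarded up to the choice of its starting
    point, is the same thing as its set of arrows. *)
Definition is_cycle (X S : finType) (M : automaton X S) (C : {set S * X}) :
    Prop :=
  exists c : seq (S * X),
    [/\ c <> [::],
        cycle (fun a b : S * X => trans M a.1 a.2 == b.1) c,
        uniq [seq a.1 | a <- c]
      & C =i c].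

Definition trivial_cycle (X S : finType) (M : automaton X S)
    (C : {set S * X}) : Prop :=
  is_cycle M C /\ exists e x, trivial_state M e /\ C = [set (e, x)]%SET.

Definition nontrivial_cycle (X S : finType) (M : automaton X S)
    (C : {set S * X}) : Prop :=
  is_cycle M C /\ ~ trivial_cycle M C.

Definition polynomial_automaton (X S : finType) (M : automaton X S) : Prop :=
  forall C D : {set S * X}, nontrivial_cycle M C -> nontrivial_cycle M D ->
    C <> D -> forall a b, a \in C -> b \in D -> a.1 <> b.1.

(** A directed path is given by the sequence of states it visits; repetitions
    are allowed. *)
Definition directed_path (X S : finType) (M : automaton X S) (p : seq S) :
    bool :=
  sorted (fun s t => [exists x, trans M s x == t]) p.

Definition cycles_met (X S : finType) (M : automaton X S) (p : seq S) : nat :=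
  #|[pred C : {set S * X} |
      `[< nontrivial_cycle M C >] && [exists a in C, a.1 \in p]]|.

Definition has_degree (X S : finType) (M : automaton X S) (m : int) : Prop :=
  (exists2 p, directed_path M p & (cycles_met M p)%:Z = m + 1) /\
  (forall p, directed_path M p -> (cycles_met M p)%:Z <= m + 1).

(** * Groups of transformations *)

Definition inverse_transf (X : finType) (g h : transf X) : Prop :=
  cancel g h /\ cancel h g.

Definition transf_group (X : finType) (H : set (transf X)) : Prop :=
  [/\ H id,
      forall g h, H g -> H h -> H (g \o h)
    & forall g, H g -> exists2 h, H h & inverse_transf g h].

(** Used only for sets [T] of bijections; these are contained in the group of
    all bijections, so that the intersection defining [smallest] is not empty. *)
Definition generated_group (X : finType) (T : set (transf X)) :
    set (transf X) :=
  smallest (@transf_group X) T.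

Definition automaton_group (X S : finType) (M : automaton X S) :
    set (transf X) :=
  generated_group (range (act M : S -> transf X)).

Definition finite_generating_set (X : finType) (G T : set (transf X)) : Prop :=
  finite_set T /\ generated_group T = G.

(** * Schreier graphs *)

Definition orbit_of (X : finType) (G : set (transf X)) (w : nat -> X) :
    set (nat -> X) :=
  [set g w | g in G].

Definition inverses (X : finType) (T : set (transf X)) : set (transf X) :=
  [set h | exists2 g, T g & inverse_transf g h].

(** The adjacency relation of the graph with vertex set [orbit_of G w]. *)
Definition schreier (X : finType) (G T : set (transf X)) (w u v : nat -> X) :
    Prop :=
  [/\ orbit_of G w u, orbit_of G w v
    & exists2 s, (T `|` inverses T) s & s v = u].

(** * Growth *)

Definition graph_ball (V : choiceType) (adj : V -> V -> Prop) (v : V)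
    (n : nat) : set V :=
  [set u | exists p : seq V,
     [/\ (size p <= n)%N, path (fun x y => `[< adj x y >]) v p
       & last v p = u]].

(** [fset_set] is the empty set on infinite sets; balls of locally finite graphs
    are finite. *)
Definition growth_function (V : choiceType) (adj : V -> V -> Prop) (v : V)
    (n : nat) : nat :=
  #|` fset_set (graph_ball adj v n)|%fset.

(** As growth functions live on [nat], the constant [C] is a positive integer;
    for nondecreasing [g] a real constant can be rounded up. *)
Definition growth_le (R : realType) (f g : nat -> R) : Prop :=
  exists2 C : nat, (0 < C)%N & forall n, f n <= g (C * n)%N.

Definition growth_equiv (R : realType) (f g : nat -> R) : Prop :=
  growth_le f g /\ growth_le g f.

(** The functions [a ^+ n] with [1 < a] are pairwise equivalent. *)
Definition subexponential (R : realType) (f : nat -> R) : Prop :=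
  forall a : R, 1 < a ->
    growth_le f (fun n => a ^+ n) /\ ~ growth_equiv f (fun n => a ^+ n).

(** Base 2 logarithm, with [log 0 = log 1 = 1]. *)
Definition log2 (R : realType) (n : nat) : R :=
  if (n <= 1)%N then 1 else ln n%:R / ln 2.

(* Main.v *)
(** Let [t_1, ..., t_p] be the letters of maximal rank in a word [g] of length
    [n], the rank of a state being the number of nontrivial cycles met by a
    path starting there.  After boundedly many levels each [t_i] lies on a
    cycle, and then it keeps its rank along a single sequence [xi_i] only.
    Push [xi_i] forward to the sequence [f_i] at the end of [g]: below a vertex,
    the letters that keep maximal rank are those whose [f_i] extends the image
    of this vertex.

    Consecutive distinct [f_i], [f_(i+1)] are related by a word of lower rank
    applied to points of a finite set, so by induction they separate within
    [d = O((log n)^k)] levels.  Hence the number of indices with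
    [f_i <> f_(i+1)] is halved every [d] levels and vanishes after
    [O((log n)^(k+1))] levels.  This gives the separation bound in the next
    rank.  It also bounds orbits: [|X|^O((log n)^(k+1))] prefixes, and then words
    whose [f_i] all coincide; these lose all their letters of maximal rank
    simultaneously, at a level determined by a word of lower rank. *)

Require Import Defs.
From HB Require Import structures.
From mathcomp Require Import all_boot all_order all_algebra perm.
From mathcomp Require Import finmap.
From mathcomp Require Import all_classical all_reals all_analysis.
From mathcomp Require Import zify ring lra.

Set Implicit Arguments.
Unset Strict Implicit.
Unset Printing Implicit Defensive.

Import Order.TTheory GRing.Theory Num.Theory.

Local Open Scope classical_set_scope.
Local Open Scope ring_scope.
Local Open Scope nat_scope.

(** * Sequences *)

Section Sequences.
Variable T : eqType.
Implicit Types (u v w : nat -> T) (j : nat).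

Definition shift w : nat -> T := fun k => w k.+1.

Definition dropn j w : nat -> T := fun k => w (j + k).

Definition scons (x : T) w : nat -> T := fun k => if k is k'.+1 then w k' else x.

Fixpoint agree j u v : bool :=
  if j is j'.+1 then (u 0 == v 0) && agree j' (shift u) (shift v) else true.

Lemma agreeP j u v : reflect (forall i, i < j -> u i = v i) (agree j u v).
Proof.
elim: j u v => [|j IH] u v /=; first exact: ReflectT.
apply: (iffP andP) => [[/eqP h0 /IH h] [|i]|h] //; first exact: h.
by split; [rewrite h | apply/IH => i hi; exact: (h i.+1)].
Qed.

Lemma agree_refl j u : agree j u u.
Proof. by apply/agreeP. Qed.

Lemma agree_sym j u v : agree j u v = agree j v u.
Proof. by apply/agreeP/agreeP => h i /h. Qed.

Lemma agree_trans j u v w : agree j u v -> agree j v w -> agree j u w.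
Proof. by move=> /agreeP h /agreeP h'; apply/agreeP => i hi; rewrite h // h'. Qed.

Lemma agree_le i j u v : i <= j -> agree j u v -> agree i u v.
Proof.
by move=> hij /agreeP h; apply/agreeP => k hk; apply: h; apply: leq_trans hij.
Qed.

Lemma agree_add i j u v :
  agree (i + j) u v = agree i u v && agree j (dropn i u) (dropn i v).
Proof. by elim: i u v => [|i IH] u v //=; rewrite IH andbA. Qed.

Lemma agree_dropn_eq j u v : agree j u v -> dropn j u = dropn j v -> u = v.
Proof.
move=> /agreeP h e; apply/funext => i; have [/h //|hi] := ltnP i j.
by have := congr1 (fun f => f (i - j)) e; rewrite /dropn subnKC.
Qed.

Lemma first_difference u v :
  u <> v -> exists2 j, agree j u v & u j <> v j.
Proof.
move=> huv; have ex : exists i, u i != v i.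
  apply: contrapT => /forallNP h; apply: huv; apply/funext => i.
  by apply/eqP/negPn/negP/h.
exists (ex_minn ex); case: ex_minnP => j /eqP hj hmin //.
apply/agreeP => i hi; apply/eqP/negPn/negP => /hmin; lia.
Qed.

Lemma separating_depth (s : seq (nat -> T)) :
  exists D, forall u v, u \in s -> v \in s -> agree D u v -> u = v.
Proof.
have sep u v : exists D, agree D u v -> u = v.
  have [->|/eqP/first_difference[j _ hj]] := eqVneq u v; first by exists 0.
  by exists j.+1 => /agreeP h; case: hj; exact: h.
have /choice[f hf] : forall p, exists D, agree D p.1 p.2 -> p.1 = p.2.
  by move=> [u v]; exact: sep.
exists (\max_(p <- [seq (u, v) | u <- s, v <- s]) f p) => u v hu hv h.
apply: (hf (u, v)); apply: agree_le h; apply: leq_bigmax_seq => //.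
by apply/allpairsP; exists (u, v).
Qed.

End Sequences.

(** * Switches *)

Section Switches.
Variable T : eqType.
Implicit Types (x : T) (l : seq T) (P : pred T).

Fixpoint switches_from x l : nat :=
  if l is y :: l' then (x != y) + switches_from y l' else 0.

Definition switches l : nat := if l is x :: l' then switches_from x l' else 0.

Lemma switches_from_le_size x l : switches_from x l <= size l.
Proof. by elim: l x => [|y l IH] x //=; have := IH y; case: (x != y); lia. Qed.

Lemma switches_le_size l : switches l <= size l.
Proof. by case: l => //= x l; apply: leq_trans (switches_from_le_size x l) _. Qed.

Lemma switches_from0 x l : switches_from x l = 0 -> forall y, y \in l -> y = x.
Proof.
elim: l x => [|z l IH] x //=; case: eqVneq => //= <- /IH h y.
by rewrite inE => /orP[/eqP|/h].
Qed.

(* Two consecutive entries satisfying [P] are equal, so a switch of the filtered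
   list jumps over a deleted entry, and costs two switches of [l]. *)
Lemma switches_filter P l :
  sorted (fun x y => [&& P x & P y] ==> (x == y)) l ->
  (switches (seq.filter P l)).*2 <= switches l.
Proof.
(* Generalization to a current entry [x]. If [x] is dropped, [y] stands for the last kept entry, and
   the extra unit on the right pays for the switch between [y] and [x]. *)
have from x l' : path (fun x y => [&& P x & P y] ==> (x == y)) x l' ->
    (P x -> (switches_from x (seq.filter P l')).*2 <= switches_from x l') /\
    (~~ P x -> forall y,
      (switches_from y (seq.filter P l')).*2 <= (switches_from x l').+1).
  elim: l' x => [|z l' IH] x //= /andP[hxz /IH [h1 h2]].
  have [hz|hz] := boolP (P z).
    split=> hx; first by move: hxz; rewrite hx hz /= => /eqP ->; rewrite eqxx h1.
    move=> y /=; have := h1 hz; have -> : x != z by apply: contraNneq hx => ->.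
    by case: (y != z); lia.
  split=> hx; last by move=> y; have := h2 hz y; case: (x != z); lia.
  have -> : x != z by apply: contraNneq hz => <-.
  by have := h2 hz x; lia.
elim: l => [|x l IH] //= hl; have [hx|hx] := boolP (P x).
  exact: (from x l hl).1.
have := IH (path_sorted hl); case: l {IH} hl => //= y l _.
by case: (x != y); lia.
Qed.

End Switches.

Lemma switches_map (T T' : eqType) (f : T -> T') (l : seq T) :
  switches (map f l) <= switches l.
Proof.
case: l => //= x l; elim: l x => //= y l IH x; have := IH y.
by case: (eqVneq x y) => [->|_]; rewrite ?eqxx //; case: (f x != f y); lia.
Qed.

(** * Words over the states of an automaton *)

Section Words.
Variables (X Q : finType) (M : automaton X Q).
Implicit Types (g h : seq Q) (s t : Q) (w u v : nat -> X).

(** The leftmost letter acts first. *)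
Definition wact g w : nat -> X := foldl (fun w s => act M s w) w g.

Fixpoint wtrans g (x : X) : seq Q :=
  if g is s :: g' then trans M s x :: wtrans g' (out M s x) else [::].

(** The section of the tree automorphism [g] at the vertex formed by the first [j] letters of
    [w]. *)
Fixpoint section j g w : seq Q :=
  if j is j'.+1 then section j' (wtrans g (w 0)) (shift w) else g.

Fixpoint state_at j s w : Q :=
  if j is j'.+1 then state_at j' (trans M s (w 0)) (shift w) else s.

Lemma wact_cat g h w : wact (g ++ h) w = wact h (wact g w).
Proof. exact: foldl_cat. Qed.

Lemma shift_wact g w : shift (wact g w) = wact (wtrans g (w 0)) (shift w).
Proof. by elim: g w => //= s g IH w; rewrite IH. Qed.

Lemma dropn_wact j g w :
  dropn j (wact g w) = wact (section j g w) (dropn j w).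
Proof.
elim: j g w => [|j IH] g w //=.
by have := IH (wtrans g (w 0)) (shift w); rewrite -shift_wact.
Qed.

Lemma wact0 g u v : (wact g u 0 == wact g v 0) = (u 0 == v 0).
Proof.
elim: g u v => //= s g IH u v; rewrite IH /=; exact: (inj_eq perm_inj).
Qed.

(** Words act by automorphisms of the rooted tree of finite words, so common prefixes keep their
    length. *)
Lemma agree_wact j g u v : agree j (wact g u) (wact g v) = agree j u v.
Proof.
elim: j g u v => //= j IH g u v; rewrite wact0 !shift_wact.
by case: eqVneq => //= <-; rewrite IH.
Qed.

Lemma wact_inj g : injective (wact g).
Proof.
move=> u v e; apply/funext => i.
have /agreeP : agree i.+1 u v by rewrite -(agree_wact _ g) e agree_refl.
exact.
Qed.

Lemma size_wtrans g x : size (wtrans g x) = size g.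
Proof. by elim: g x => //= s g IH x; rewrite IH. Qed.

Lemma size_section j g w : size (section j g w) = size g.
Proof. by elim: j g w => //= j IH g w; rewrite IH size_wtrans. Qed.

Lemma mem_wtrans g x s :
  s \in wtrans g x -> exists2 t, t \in g & exists y, s = trans M t y.
Proof.
elim: g x => //= t g IH x; rewrite inE => /orP[/eqP ->|/IH[t' ht' e]].
  by exists t; [exact: mem_head | exists x].
by exists t' => //; rewrite inE ht' orbT.
Qed.

Lemma mem_section j g w s :
  s \in section j g w -> exists2 t, t \in g & exists v, s = state_at j t v.
Proof.
elim: j g w => [|j IH] g w /=; first by move=> h; exists s => //; exists w.
move=> /IH [t /mem_wtrans[t' ht' [y ->]] [v ->]]; exists t' => //.
by exists (scons y v).
Qed.

Lemma all_wtrans (P : pred Q) g x :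
  (forall s y, P s -> P (trans M s y)) -> all P g -> all P (wtrans g x).
Proof.
by move=> hP /allP h; apply/allP => s /mem_wtrans [t /h ht [y ->]]; exact: hP.
Qed.

Lemma all_section (P : pred Q) j g w :
  (forall s y, P s -> P (trans M s y)) -> all P g -> all P (section j g w).
Proof.
by move=> hP; elim: j g w => //= j IH g w h; apply: IH; exact: all_wtrans.
Qed.

End Words.

(** * Covering numbers *)

Section Covers.
Variable X : finType.
Implicit Types (E F : set (nat -> X)) (N : nat).

Definition covered E N : Prop :=
  exists2 l : seq (nat -> X), size l <= N & forall z, E z -> z \in l.

Lemma covered_sub E F N N' :
  E `<=` F -> N <= N' -> covered F N -> covered E N'.
Proof.
move=> hEF hN [l hl h]; exists l; first exact: leq_trans hN.
by move=> z /hEF /h.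
Qed.

Lemma covered1 z : covered [set z] 1.
Proof. by exists [:: z] => // _ ->; exact: mem_head. Qed.

Lemma coveredU E F N N' :
  covered E N -> covered F N' -> covered (E `|` F) (N + N').
Proof.
move=> [l hl h] [l' hl' h']; exists (l ++ l'); first by rewrite size_cat leq_add.
by move=> z [/h|/h'] hz; rewrite mem_cat hz ?orbT.
Qed.

Lemma covered_bigcup (I : eqType) (l : seq I) (E : I -> set (nat -> X)) a N :
  size l <= a -> (forall i, i \in l -> covered (E i) N) ->
  covered [set z | exists2 i, i \in l & E i z] (a * N).
Proof.
move=> hl h; apply: (@covered_sub _ [set z | exists2 i, i \in l & E i z]
  (size l * N)) => //; first by rewrite leq_mul2r hl orbT.
elim: l h {hl} => [|i l IH] h; first by exists [::] => // z [].
have IH' : covered [set z | exists2 i, i \in l & E i z] (size l * N).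
  by apply: IH => k hk; apply: h; rewrite inE hk orbT.
apply: covered_sub (leqnn _) (coveredU (h i (mem_head _ _)) IH') => z [k].
by rewrite inE => /orP[/eqP ->|hk] hz; [left|right; exists k].
Qed.

Lemma covered_shift E N : covered [set shift z | z in E] N -> covered E (#|X| * N).
Proof.
move=> [l hl h]; exists [seq scons x t | x <- enum X, t <- l].
  by rewrite size_allpairs -cardE leq_mul2l hl orbT.
move=> z hz; apply/allpairsP; exists (z 0, shift z); split.
- by rewrite mem_enum.
- by apply: h; exists z.
- by apply/funext => -[].
Qed.

Lemma covered_dropn j E N :
  covered [set dropn j z | z in E] N -> covered E (#|X| ^ j * N).
Proof.
elim: j E => [|j IH] E h.
  rewrite expn0 mul1n; apply: covered_sub h => // z hz; by exists z.
rewrite expnS -mulnA; apply: covered_shift; apply: IH.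
apply: covered_sub h => // _ [_ [z hz <-] <-]; by exists z.
Qed.

(** Unlike in [covered_dropn], no factor is lost, because the prefix is prescribed. *)
Lemma covered_prefix j v E N : (forall z, E z -> agree j z v) ->
  covered [set dropn j z | z in E] N -> covered E N.
Proof.
move=> hE [l hl h].
exists [seq (fun i => if i < j then v i else t (i - j)) | t <- l].
  by rewrite size_map.
move=> z hz; apply/mapP; exists (dropn j z); first by apply: h; exists z.
apply/funext => i; have /agreeP hag := hE _ hz.
by case: ltnP => hi; [exact: hag | rewrite /dropn subnKC].
Qed.

End Covers.

(** * Layered automata *)

(** What the counting needs from a polynomial automaton: ranks, the states on nontrivial cycles, the
    letter that stays on the cycle, and a level [L] by which the transient behaviour is over. These
    properties pass to the automaton with inverse states, which need not be minimized. *)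
Record layered (X Q : finType) (M : automaton X Q) (rk : Q -> nat)
    (cyc : pred Q) (xi : Q -> X) (L : nat) : Prop := Layered {
  rk_trans : forall s x, rk (trans M s x) <= rk s ;
  rk0_trivial : forall s w, rk s = 0 -> trivial_state M (state_at M L s w) ;
  cyc_state_at : forall s w, 0 < rk s -> rk (state_at M L s w) = rk s ->
    cyc (state_at M L s w) ;
  cyc_trans : forall s, cyc s -> cyc (trans M s (xi s)) ;
  rk_cyc_trans : forall s x, cyc s -> (rk (trans M s x) == rk s) = (x == xi s) }.

Section Layered.
Variables (X Q : finType) (M : automaton X Q) (rk : Q -> nat) (cyc : pred Q).
Variables (xi : Q -> X) (L : nat).
Hypothesis layM : layered M rk cyc xi L.
Implicit Types (g h : seq Q) (s t : Q) (w u v a b : nat -> X) (k n d : nat).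

Local Notation wact := (wact M).
Local Notation section := (section M).
Local Notation wtrans := (wtrans M).

(* The sequence read along the cycle through [s]: the only sequence along which
   a cyclic state keeps its rank. *)
Fixpoint singular s (n : nat) {struct n} : X :=
  if n is n'.+1 then singular (trans M s (xi s)) n' else xi s.

Definition singular_image s : nat -> X := act M s (singular s).

(** A finite set closed under [shift], so that separation can be iterated below any vertex. *)
Definition singular_points : seq (nat -> X) :=
  [seq singular s | s <- enum Q] ++ [seq singular_image s | s <- enum Q].

Lemma singularP s : singular s \in singular_points.
Proof. by rewrite mem_cat map_f // mem_enum. Qed.

Lemma singular_imageP s : singular_image s \in singular_points.
Proof. by rewrite mem_cat [X in _ || X]map_f ?mem_enum ?orbT. Qed.

Lemma shift_singular_points a :
  a \in singular_points -> shift a \in singular_points.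
Proof.
rewrite mem_cat => /orP[] /mapP[s _ ->].
  exact: (singularP (trans M s (xi s))).
exact: (singular_imageP (trans M s (xi s))).
Qed.

Lemma dropn_singular_points j a :
  a \in singular_points -> dropn j a \in singular_points.
Proof.
elim: j a => [|j IH] a ha //.
exact: (IH (shift a) (shift_singular_points ha)).
Qed.

(** * Words of bounded rank and their marks *)

Definition low k g := all (fun s => rk s < k) g.

(** The form that words of rank at most [k] take after [L] levels, for [0 < k]; sections preserve
    it. *)
Definition tidy k g := all (fun s => (rk s <= k) && ((rk s == k) ==> cyc s)) g.

Lemma rk_state_at j s w : rk (state_at M j s w) <= rk s.
Proof.
elim: j s w => //= j IH s w; apply: leq_trans (IH _ _) _; exact: rk_trans layM _ _.
Qed.

Lemma tidy_section k j g w : tidy k g -> tidy k (section j g w).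
Proof.
apply: all_section => s y /andP[hs /implyP hc].
have hle := rk_trans layM s y; rewrite (leq_trans hle hs) /=.
apply/implyP => /eqP e; have e' : rk s = k by apply/eqP; rewrite eqn_leq hs -e.
have cs : cyc s by apply: hc; rewrite e'.
have : y == xi s by rewrite -(rk_cyc_trans layM) // e e'.
by move=> /eqP ->; exact: (cyc_trans layM).
Qed.

Lemma tidy_section_L k g w : 0 < k -> low k.+1 g -> tidy k (section L g w).
Proof.
move=> k0 /allP hg; apply/allP => s /mem_section[t /hg ht [v ->]].
rewrite (leq_trans (rk_state_at _ _ _)) //=; apply/implyP => /eqP e.
have e' : rk t = k by apply/eqP; rewrite eqn_leq -ltnS ht -e rk_state_at.
by apply: (cyc_state_at layM); rewrite ?e'.
Qed.

Lemma low1_section_L g w u : low 1 g -> wact (section L g w) u = u.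
Proof.
move=> /allP hg.
have : all (fun s => `[< trivial_state M s >]) (section L g w).
  apply/allP => s /mem_section[t /hg ht [v ->]]; apply/asboolP.
  by apply: (rk0_trivial layM); case: (rk t) ht.
by elim: (section L g w) u => //= s h IH u /andP[/asboolP -> /IH].
Qed.

(* The images under [g] of the points along which a letter of rank [k] of the
   tidy word [g] never loses its rank. *)
Fixpoint marks k g : seq (nat -> X) :=
  if g is s :: g' then
    if rk s == k then wact g (singular s) :: marks k g' else marks k g'
  else [::].

Lemma size_marks k g : size (marks k g) <= size g.
Proof. by elim: g => //= s g IH; case: eqP => _ //=; exact: leqW. Qed.

Lemma tidy_marks0 k g : tidy k g -> marks k g = [::] -> low k g.
Proof.
elim: g => //= s g IH /andP[/andP[h1 h2] h3]; case: eqP => // e /(IH h3) ->.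
by rewrite andbT ltn_neqAle h1 andbT; apply/eqP.
Qed.

(** A letter [s] of rank [k] keeps its rank exactly when it reads [xi s]; pushed to the end of the
    word, this says that its mark starts with the image of [x]. The constant sequence stands for any
    sequence starting with [x]. *)
Lemma marks_wtrans k g x : tidy k g ->
  marks k (wtrans g x) =
  [seq shift f | f <- marks k g & f 0 == wact g (fun=> x) 0].
Proof.
elim: g x => //= s g IH x /andP[/andP[h1 /implyP h2] h3].
have e0 : wact g (act M s (fun=> x)) 0 = wact g (fun=> out M s x) 0.
  by apply/eqP; rewrite wact0.
rewrite {}e0 (IH _ h3); case: (eqVneq (rk s) k) => [e|ne]; last first.
  have /negbTE -> // : rk (trans M s x) != k.
  have := rk_trans layM s x; lia.
have cs : cyc s by apply: h2; rewrite e.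
have -> : (rk (trans M s x) == k) = (x == xi s).
  by rewrite -e; exact: rk_cyc_trans layM _ _ _.
rewrite /= wact0 /= (inj_eq perm_inj) (eq_sym (xi s)).
case: eqVneq => // -> /=; congr (_ :: _).
by rewrite shift_wact.
Qed.

Lemma marks_section k j g w : tidy k g ->
  marks k (section j g w) =
  [seq dropn j f | f <- marks k g & agree j f (wact g w)].
Proof.
elim: j g w => [|j IH] g w hg /=.
  by rewrite seq.filter_predT map_id.
rewrite IH; last by have := @tidy_section k 1 g w hg.
rewrite (marks_wtrans _ hg) seq.filter_map -map_comp -filter_predI.
congr map; apply: eq_filter => f /=; rewrite shift_wact andbC; congr andb.
by congr (_ == _); apply/eqP; rewrite wact0.
Qed.

(** * Separation of singular points *)

Definition separates k n d := forall g a b, low k g -> size g <= n ->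
  a \in singular_points -> b \in singular_points ->
  agree d (wact g a) b -> wact g a = b.

Lemma separates_le k n d d' : d <= d' -> separates k n d -> separates k n d'.
Proof. by move=> hd h g a b h1 h2 h3 h4 /(agree_le hd); exact: h. Qed.

Definition agree_eq d u v := agree d u v ==> (u == v).

Lemma agree_eq_wact d g u v : agree_eq d (wact g u) (wact g v) = agree_eq d u v.
Proof. by rewrite /agree_eq agree_wact (inj_eq (@wact_inj _ _ M g)). Qed.

(** Stripping the common end of the word from two consecutive entries preserves agreement. What
    remains compares a singular point, moved by the low letters between two letters of rank [k],
    with another singular point. The word [h] collects these low letters. *)
Lemma path_marks k n d g h a b : separates k n d ->
  low k h -> size h + size g <= n -> tidy k g ->
  a \in singular_points -> b \in singular_points ->
  path (agree_eq d) (wact (h ++ g) a) (rcons (marks k g) b).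
Proof.
move=> sep; elim: g h a => [|s g IH] h a hh hsz hg ha hb /=.
  by rewrite cats0 andbT; apply/implyP => e; apply/eqP; apply: sep => //; lia.
have /andP[/andP[h1 _] h3] := hg; rewrite /= in hsz.
case: (eqVneq (rk s) k) => [e|ne] /=; last first.
  rewrite -cat_rcons; apply: IH => //; last by rewrite size_rcons; lia.
  by rewrite /low all_rcons [all _ _]hh andbT ltn_neqAle ne.
apply/andP; split; last first.
  apply: (IH [::]) => //; last exact: singular_imageP.
  by apply: leq_trans hsz; rewrite add0n addnS ltnW // ltnS leq_addl.
rewrite wact_cat (agree_eq_wact _ (s :: g)).
apply/implyP => e'; apply/eqP; apply: sep => //; last exact: singularP.
by apply: leq_trans hsz; rewrite leq_addr.
Qed.

Lemma sorted_marks k n d g : separates k n d -> size g <= n -> tidy k g ->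
  sorted (agree_eq d) (marks k g).
Proof.
case: g => // s g sep hsz hg.
(* The two end points are dummies and are cut off afterwards. *)
have /path_sorted :=
  @path_marks k n d _ [::] _ _ sep isT hsz hg (singularP s) (singularP s).
by rewrite -cats1 => /cat_sorted2[].
Qed.

(** The marks that survive [d] levels all agree with the image of [w], hence with each other, so
    neighbouring survivors are equal. *)
Lemma switches_marks_section k n d g w :
  separates k n d -> size g <= n -> tidy k g ->
  (switches (marks k (section d g w))).*2 <= switches (marks k g).
Proof.
move=> sep hsz hg; rewrite marks_section //.
apply: leq_trans (switches_filter (P := fun f => agree d f (wact g w)) _).
  by rewrite leq_double switches_map.
apply: sub_sorted (sorted_marks sep hsz hg) => u v /implyP h.
apply/implyP => /andP[hu hv]; apply: h; apply: agree_trans hu _.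
by rewrite agree_sym.
Qed.

(** After this many halvings, a list with at most [n + 1] switches has none left. *)
Definition rounds n := (trunc_log 2 n.+1).+1.

Lemma rounds_gt n : n.+1 < 2 ^ rounds n.
Proof. exact: trunc_log_ltn. Qed.

(** The image of [a] and the point [b] are added to the marks as first and last entries. As they
    agree for [d] levels, both survive each filtering; after [r] halvings no switch is left, and the
    two ends coincide. *)
Lemma separates_tidy k n d r g a b : separates k n d -> tidy k g ->
  size g <= n -> a \in singular_points -> b \in singular_points ->
  switches (wact g a :: rcons (marks k g) b) < 2 ^ r ->
  agree (d * r) (wact g a) b -> wact g a = b.
Proof.
move=> sep; elim: r g a b => [|r IH] g a b hg hsz ha hb.
  rewrite expn0 ltnS leqn0 => /eqP/switches_from0 h _.
  by rewrite (h b) // mem_rcons mem_head.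
move=> hsw; rewrite mulnS agree_add => /andP[hd hr].
apply: (agree_dropn_eq hd); rewrite dropn_wact; apply: IH => //.
- exact: tidy_section.
- by rewrite size_section.
- exact: dropn_singular_points.
- exact: dropn_singular_points.
- set P := fun f => agree d f (wact g a).
  have -> : wact (section d g a) (dropn d a) ::
      rcons (marks k (section d g a)) (dropn d b) =
      [seq dropn d f | f <- wact g a :: rcons (marks k g) b & P f].
    rewrite marks_section //= /P agree_refl /= -dropn_wact filter_rcons.
    by rewrite agree_sym hd map_rcons.
  have hs : sorted (fun x y => [&& P x & P y] ==> (x == y))
      (wact g a :: rcons (marks k g) b).
    have := @path_marks k n d _ [::] _ _ sep isT hsz hg ha hb.
    apply: sub_path => u v /implyP h.
    apply/implyP => /andP[hu hv]; apply: h; apply: agree_trans hu _.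
    by rewrite agree_sym.
  rewrite -ltn_double -[(2 ^ r).*2]mul2n -expnS; apply: leq_ltn_trans hsw.
  apply: leq_trans (switches_filter hs); rewrite leq_double.
  exact: switches_map.
- by rewrite -dropn_wact.
Qed.

Lemma separation k : exists C, forall n, separates k.+1 n (C * rounds n ^ k).
Proof.
elim: k => [|k [C IH]].
  have [D hD] := separating_depth singular_points.
  (* After [L] levels a word of rank 0 acts trivially, and [D] more levels separate the finitely
     many singular points. *)
  exists (L + D) => n; rewrite expn0 muln1 => g a b hg hsz ha hb.
  rewrite agree_add => /andP[hL]; rewrite dropn_wact low1_section_L // => h.
  apply: (agree_dropn_eq hL); rewrite dropn_wact low1_section_L //.
  by apply: hD h; exact: dropn_singular_points.
exists (L + C) => n.
(* [L] levels make the word tidy; then come [rounds n] rounds of the depth known for the lower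
   rank. *)
apply: (@separates_le _ _ (L + C * rounds n ^ k * rounds n)).
  rewrite mulnDl -mulnA -expnSr leq_add2r leq_pmulr //.
  by rewrite expn_gt0.
move=> g a b hg hsz ha hb; rewrite agree_add => /andP[hL h].
apply: (agree_dropn_eq hL); rewrite dropn_wact.
apply: (separates_tidy (IH n) (r := rounds n)).
- exact: tidy_section_L.
- by rewrite size_section.
- exact: dropn_singular_points.
- exact: dropn_singular_points.
- apply: leq_ltn_trans (rounds_gt n) => /=.
  apply: leq_trans (switches_from_le_size _ _) _.
  by rewrite size_rcons ltnS (leq_trans (size_marks _ _)) // size_section.
- by rewrite -dropn_wact.
Qed.

(** * Counting *)

Definition low_orbit k n w : set (nat -> X) :=
  [set z | exists g, [/\ low k g, size g <= n & z = wact g w]].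

Lemma marks_first k g f l : marks k g = f :: l -> exists h t g',
  [/\ g = h ++ t :: g', forall s, s \in h -> rk s != k
    & f = wact (t :: g') (singular t)].
Proof.
elim: g => //= s g IH; case: (eqVneq (rk s) k) => [_ [<- _]|ne /IH].
  by exists [::], s, g.
move=> [h [t [g' [-> hh ->]]]]; exists (s :: h), t, g'; split => // q.
by rewrite inE => /orP[/eqP ->|/hh].
Qed.

(** Behind the last letter of rank [k] the word is low, so the last mark lies in a low orbit of a
    singular point. *)
Lemma marks_last k g f0 : marks k g <> [::] -> tidy k g -> exists h t,
  [/\ low k h, size h <= size g & last f0 (marks k g) = wact h (singular_image t)].
Proof.
elim: g f0 => //= s g IH f0 hne /andP[_ hg].
have [e|/eqP ne] := eqVneq (marks k g) [::]; last first.
  case: ifP hne => _ _ /=.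
    have [h [t [h1 h2 h3]]] := IH (wact (s :: g) (singular s)) ne hg.
    by exists h, t; split => //; exact: leqW.
  have [h [t [h1 h2 h3]]] := IH f0 ne hg.
  by exists h, t; split => //; exact: leqW.
case: ifP hne; rewrite e //= => _ _; exists g, s; split => //.
exact: tidy_marks0.
Qed.

(* All marks are equal to one point [f], the image of a singular point under a
   word of rank [< k].  The image [z] of [w] leaves [f] at the level where the
   image of [w] under the letters preceding the first mark leaves another
   singular point; below this level all letters have rank [< k]. *)
Lemma covered_no_switch k n N w : (forall v, covered (low_orbit k n v) N) ->
  covered [set z | exists g, [/\ tidy k g, size g <= n,
                               switches (marks k g) = 0 & z = wact g w]]
    (N + size singular_points * N * (N * (size singular_points * (1 + #|X| * N)))).
Proof.
move=> hN.
have [lw hlw hw] := hN w.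
have [lf hlf hf] : covered
    [set z | exists2 a, a \in singular_points & low_orbit k n a z]
    (size singular_points * N) by exact: covered_bigcup.
(* Here [y] is the image of [w] before the first mark and [a] the singular point of that letter;
   [E f y a] collects [f] itself and the points leaving [f] where [y] leaves [a], with a tail moved
   by a low word. *)
pose E f y a := [set z | z = f] `|` [set z | exists j,
  [/\ agree j y a, y j <> a j, agree j z f
    & low_orbit k n (dropn j.+1 w) (dropn j.+1 z)]].
have hE f y a : covered (E f y a) (1 + #|X| * N).
  apply: coveredU; first exact: covered1.
  have [->|/eqP/first_difference [j hj hne]] := eqVneq y a.
    by exists [::] => // z [j [_]].
  (* The level of departure is determined by [y] and [a], so the prefix up to it is fixed. *)
  have uj i : agree i y a -> y i <> a i -> i = j.
    move=> hi hnei; case: (ltngtP i j) => // hij.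
      by case: hnei; move/agreeP: hj; exact.
    by case: hne; move/agreeP: hi; exact.
  apply: (@covered_prefix _ j f) => [z [i [h1 h2 h3 _]]|].
    by rewrite -(uj i h1 h2).
  apply: covered_shift; apply: covered_sub (leqnn _) (hN (dropn j.+1 w)).
  move=> _ [_ [z [i [h1 h2 _ h3]] <-] <-]; rewrite (uj i h1 h2) in h3.
  have -> // : shift (dropn j z) = dropn j.+1 z.
  by apply/funext => m; rewrite /shift /dropn addnS.
have hEE : covered [set z | exists2 f, f \in lf & exists2 y, y \in lw &
    exists2 a, a \in singular_points & E f y a z]
  (size singular_points * N * (N * (size singular_points * (1 + #|X| * N)))).
  apply: (covered_bigcup (E := fun f => [set z | exists2 y, y \in lw &
    exists2 a, a \in singular_points & E f y a z])) => // f _.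
  apply: (covered_bigcup (E := fun y => [set z |
    exists2 a, a \in singular_points & E f y a z])) => // y _.
  by apply: (covered_bigcup (E := fun a => E f y a)) => // a _; exact: hE.
apply: covered_sub (leqnn _) (coveredU (hN w) hEE) => z [g [hg hsz hsw ->]].
case hm : (marks k g) => [|f l].
  by left; exists g; split => //; exact: tidy_marks0 hm.
right; have eqf : forall f', f' \in marks k g -> f' = f.
  move: hsw; rewrite hm => /switches_from0 h f'.
  by rewrite inE => /orP[/eqP|/h].
have [h1 [t1 [hl1 hsz1 e1]]] := marks_last f (g := g) (k := k)
  ltac:(by rewrite hm) hg.
have {}e1 : f = wact h1 (singular_image t1).
  by rewrite -e1; apply/esym/eqf; rewrite hm /= mem_last.
have [h [t [g' [eg hh ef]]]] := marks_first hm.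
have hlow : low k h.
  apply/allP => s hs; have /allP/(_ s) := hg; rewrite eg mem_cat hs => /(_ isT).
  by move=> /andP[hle _]; rewrite ltn_neqAle (hh _ hs).
exists f.
  apply: hf; exists (singular_image t1); first exact: singular_imageP.
  by exists h1; split => //; exact: leq_trans hsz.
exists (wact h w).
  apply: hw; exists h; split => //; apply: leq_trans hsz.
  by rewrite eg size_cat leq_addr.
exists (singular t); first exact: singularP.
have ez : wact g w = wact (t :: g') (wact h w) by rewrite eg wact_cat.
have [e|/eqP/first_difference [j hj hne]] := eqVneq (wact h w) (singular t).
  by left; rewrite /= ez e ef.
right; exists j; split => //; first by rewrite ez ef agree_wact.
rewrite dropn_wact; exists (section j.+1 g w); split => //; last first.
  by rewrite size_section.
apply: tidy_marks0; first exact: tidy_section.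
(* A surviving mark would be [f], and agreement with [f] through level [j] would contradict the
   choice of [j]. *)
apply/nilP; rewrite /nilp marks_section // size_map size_filter -leqn0 leqNgt.
rewrite -has_count.
apply/hasPn => f' /eqf ->; apply/negP => hag; apply: hne; symmetry.
have : agree j.+1 (singular t) (wact h w).
  by rewrite -(agree_wact M j.+1 (t :: g')) -ef -ez.
by move=> /agreeP; exact.
Qed.

(** Each round descends [d] levels, at the price of [#|X| ^ d] prefixes, and halves the switches. *)
Lemma covered_tidy k n d N r w : separates k n d ->
  (forall v, covered [set z | exists g, [/\ tidy k g, size g <= n,
                       switches (marks k g) = 0 & z = wact g v]] N) ->
  covered [set z | exists g, [/\ tidy k g, size g <= n,
                       switches (marks k g) < 2 ^ r & z = wact g w]]
    (#|X| ^ (d * r) * N).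
Proof.
move=> sep hN; elim: r w => [|r IH] w.
  rewrite muln0 mul1n; apply: covered_sub (leqnn _) (hN w) => z [g [h1 h2 h3 h4]].
  by exists g; split => //; move: h3; rewrite expn0; case: switches.
rewrite mulnS expnD -mulnA; apply: covered_dropn.
apply: covered_sub (leqnn _) (IH (dropn d w)) => _ [z [g [h1 h2 h3 ->]] <-].
exists (section d g w); split.
- exact: tidy_section.
- by rewrite size_section.
- rewrite -ltn_double -[(2 ^ r).*2]mul2n -expnS; apply: leq_ltn_trans h3.
  by apply: switches_marks_section sep _ _.
- exact: dropn_wact.
Qed.

Lemma orbit_growth k : exists2 B, 0 < B &
  forall n w, covered (low_orbit k.+1 n w) (B ^ (rounds n ^ k)).
Proof.
elim: k => [|k [B B0 IH]].
  exists (#|X| ^ L).+1 => // n w; rewrite expn0 expn1.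
  apply: (@covered_sub _ _ (low_orbit 1 n w) (#|X| ^ L * 1)) => //.
    by rewrite muln1 leqnSn.
  apply: covered_dropn; apply: covered_sub (leqnn _) (covered1 (dropn L w)).
  by move=> _ [z [g [h1 h2 ->]] <-]; rewrite dropn_wact low1_section_L.
have [C sep] := separation k; pose c := size singular_points.
(* The first factor bounds the prefixes of all rounds, the second the orbits of words without
   switches, whose number is cubic in the bound [P] for the lower rank. The successor keeps the base
   positive. *)
exists (#|X|.+1 ^ (L + C) * (B ^ 3 * (1 + c ^ 2 * (1 + #|X|)))).
  by rewrite !muln_gt0 !expn_gt0 B0.
move=> n w; set K := rounds n; set P := B ^ (K ^ k).
have P0 : 0 < P by rewrite expn_gt0 B0.
pose N1 := P + c * P * (P * (c * (1 + #|X| * P))).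
have h1 : covered (low_orbit k.+2 n w)
    (#|X| ^ L * (#|X| ^ (C * K ^ k * K) * N1)).
  apply: covered_dropn; apply: covered_sub (leqnn _)
    (covered_tidy K (dropn L w) (sep n)
      (fun v => covered_no_switch v (fun u => IH n u))).
  move=> _ [z [g [h1 h2 ->]] <-]; exists (section L g w); split.
  - exact: tidy_section_L.
  - by rewrite size_section.
  - apply: leq_ltn_trans (switches_le_size _) _.
    apply: leq_ltn_trans (size_marks _ _) _; rewrite size_section.
    by apply: leq_ltn_trans (rounds_gt n); exact: leqW.
  - exact: dropn_wact.
apply: covered_sub h1 => //.
have K0 : 0 < K ^ k.+1 by rewrite expn_gt0.
have le1 x : 0 < x -> x <= x ^ (K ^ k.+1).
  by move=> x0; rewrite -{1}(expn1 x) leq_pexp2l.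
have mono x y e : x <= y -> x ^ e <= y ^ e.
  by case: e => [|e] // hxy; rewrite leq_exp2r.
have hX : #|X| ^ L * #|X| ^ (C * K ^ k * K) <= (#|X|.+1 ^ (L + C)) ^ (K ^ k.+1).
  rewrite expnD expnMn -[C * _ * _]mulnA -expnSr leq_mul //.
    apply: leq_trans (mono _ _ L (leqnSn #|X|)) _.
    by apply: le1; rewrite expn_gt0.
  by rewrite -expnM; exact: mono.
have hP : P ^ 3 <= (B ^ 3) ^ (K ^ k.+1).
  rewrite -!expnM leq_pexp2l // mulnC leq_mul2l /= leq_pexp2l //.
have hN1 : N1 <= P ^ 3 * (1 + c ^ 2 * (1 + #|X|)).
  have hq : 1 + #|X| * P <= P * (1 + #|X|) by rewrite mulnDr muln1 mulnC leq_add2r.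
  have -> : P ^ 3 * (1 + c ^ 2 * (1 + #|X|)) =
      P ^ 3 + c * P * (P * (c * (P * (1 + #|X|)))).
    by rewrite !expnS expn0; ring.
  rewrite leq_add //; first by rewrite -{1}(expn1 P) leq_pexp2l.
  by rewrite !leq_mul.
rewrite mulnA expnMn leq_mul //; apply: leq_trans hN1 _.
by rewrite expnMn leq_mul // le1.
Qed.

End Layered.

(** * Polynomial automata are layered *)

Section Polynomial.
Variables (X S : finType) (M : automaton X S).
Hypotheses (hmin : minimized M) (hpol : polynomial_automaton M).
Implicit Types (s t : S) (x : X) (w : nat -> X) (C : {set S * X}).

Let arrow : rel (S * X) := fun a b => trans M a.1 a.2 == b.1.
Let edge : rel S := fun s t => [exists x, trans M s x == t].

Lemma edge_trans s x : edge s (trans M s x).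
Proof. by apply/existsP; exists x. Qed.

Lemma path_arrow_edge a p : path arrow a p -> path edge a.1 [seq b.1 | b <- p].
Proof. by apply: homo_path => b c /eqP <-; exact: edge_trans. Qed.

Lemma trivial_state_trans s x : trivial_state M s -> trivial_state M (trans M s x).
Proof. by move=> h w; exact: (congr1 (@shift X) (h (scons x w))). Qed.

(** Minimization identifies the trivially acting successor with [s], so all arrows from a trivial
    state are loops. *)
Lemma trivial_state_fixed s x : trivial_state M s -> trans M s x = s.
Proof.
move=> h; apply: hmin; apply/funext => w; rewrite h.
exact: trivial_state_trans.
Qed.

(** * Cycles in the graph of the automaton *)

Definition on_cycle C s := [exists a in C, a.1 == s].

Lemma on_cycleP C s : reflect (exists x, (s, x) \in C) (on_cycle C s).
Proof.
apply: (iffP existsP) => [[[t x] /andP[h /eqP /= <-]]|[x h]]; first by exists x.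
by exists (s, x); rewrite h eqxx.
Qed.

Lemma cycle_rot C a : is_cycle M C -> a \in C -> exists p,
  [/\ path arrow a (rcons p a), uniq [seq b.1 | b <- a :: p] & C =i a :: p].
Proof.
move=> [c [_ hc hu hC]]; rewrite hC => /rot_to [i p e]; exists p; split.
- by move: hc; rewrite -(rot_cycle i) e.
- by rewrite -e map_rot rot_uniq.
- by move=> b; rewrite hC -e mem_rot.
Qed.

Lemma cycle_arrow_uniq C s x y :
  is_cycle M C -> (s, x) \in C -> (s, y) \in C -> x = y.
Proof.
move=> hC hx; have [p [_ /= /andP[hu _] e]] := cycle_rot hC hx.
rewrite e inE => /orP[/eqP[->//]|/(map_f fst) /= hs].
by rewrite hs in hu.
Qed.

Lemma cycle_trans C s x :
  is_cycle M C -> (s, x) \in C -> on_cycle C (trans M s x).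
Proof.
move=> hC h; have [p [hp _ e]] := cycle_rot hC h.
case: p hp e => [|[t y] p] /= /andP[/eqP /= -> _] e; apply/on_cycleP.
  by exists x.
by exists y; rewrite e !inE eqxx orbT.
Qed.

Lemma cycle_connect C s t : is_cycle M C -> on_cycle C s -> on_cycle C t ->
  connect edge s t.
Proof.
move=> hC /on_cycleP[x hx] /on_cycleP[y hy]; have [p [hp _ e]] := cycle_rot hC hx.
apply: (path_connect (path_arrow_edge hp)); rewrite map_rcons inE mem_rcons.
move: hy; rewrite e => /(map_f fst) /=.
by move=> ->; rewrite orbT.
Qed.

Lemma arrows_of_path a v p x : path edge v p -> trans M a.1 a.2 = v -> exists c,
  path arrow a (rcons c (last v p, x)) /\ [seq b.1 | b <- c] = belast v p.
Proof.
elim: p a v => [|v' p IH] a v /=.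
  by move=> _ e; exists [::]; rewrite /= /arrow e eqxx.
move=> /andP[/existsP[y /eqP hy] hp] e.
have [c [hc hm]] := IH (v, y) v' hp hy.
by exists ((v, y) :: c); rewrite /= hm /arrow /= e eqxx.
Qed.

(** A return path to [s] can be made simple; its arrows then close up with [(s, x)] to a simple
    cycle. *)
Lemma connect_cycle s x : connect edge (trans M s x) s ->
  exists2 C, is_cycle M C & (s, x) \in C.
Proof.
move=> /connectP[p0 hp0 e0]; case: (shortenP hp0) e0 => p hp hu _ es.
have [c [hc hm]] := @arrows_of_path (s, x) _ _ x hp erefl.
exists [set a in (s, x) :: c]%SET; last by rewrite inE mem_head.
exists ((s, x) :: c); split => //.
- by rewrite -es in hc.
- by move: hu; rewrite lastI rcons_uniq -es /= hm.
- by move=> a; rewrite inE.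
Qed.

Lemma nontrivial_cycle_state C s :
  nontrivial_cycle M C -> on_cycle C s -> ~ trivial_state M s.
Proof.
move=> [hC hn] /on_cycleP[x hx] ht; apply: hn; split => //; exists s, x; split => //.
have [p [hp hu e]] := cycle_rot hC hx.
case: p hp hu e => [|[t y] p] /= /andP[/eqP /=]; rewrite trivial_state_fixed //.
  by move=> _ _ _ e; apply/setP => b; rewrite e !inE.
by move=> -> _; rewrite inE eqxx.
Qed.

Definition cyclic s := `[< exists2 C, nontrivial_cycle M C & on_cycle C s >].

Lemma cyclicP s :
  reflect (exists2 C, nontrivial_cycle M C & on_cycle C s) (cyclic s).
Proof. exact: asboolP. Qed.

Lemma cycle_of_cyclic C s : cyclic s -> is_cycle M C -> on_cycle C s ->
  nontrivial_cycle M C.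
Proof.
move=> /cyclicP[D hD hs] hC hCs; split => // -[_ [e [x [he eC]]]].
move/on_cycleP: hCs => [y]; rewrite eC inE => /eqP[es _].
by apply: (nontrivial_cycle_state hD hs); rewrite es.
Qed.

Lemma nontrivial_cycle_uniq C D s : nontrivial_cycle M C -> nontrivial_cycle M D ->
  on_cycle C s -> on_cycle D s -> C = D.
Proof.
move=> hC hD /on_cycleP[x hx] /on_cycleP[y hy]; apply: contrapT => ne.
exact: (hpol hC hD ne hx hy).
Qed.

(** * Nontrivial cycles met by paths, and ranks of states *)

Definition cycles_of (p : seq S) : pred {set S * X} :=
  [pred C | `[< nontrivial_cycle M C >] && [exists a in C, a.1 \in p]].

Lemma cycles_ofP p C :
  reflect (nontrivial_cycle M C /\ exists2 s, s \in p & on_cycle C s)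
          (cycles_of p C).
Proof.
apply: (iffP andP) => [[/asboolP h /existsP[[s x] /andP[hx hs]]]|[h [s hs]]].
  by split => //; exists s => //; apply/on_cycleP; exists x.
move=> /on_cycleP[x hx]; split; first exact/asboolP.
by apply/existsP; exists (s, x); rewrite hx.
Qed.

Lemma cycles_met_sub p q : {subset p <= q} -> cycles_met M p <= cycles_met M q.
Proof.
move=> h; apply: subset_leq_card; apply/fintype.subsetP => C.
move=> /cycles_ofP[hC [s /h hs hCs]]; apply/cycles_ofP.
by split => //; exists s.
Qed.

(** The maximum over paths from [s] exists because there are finitely many sets of arrows. *)
Lemma rank_exists : exists rk : S -> nat,
  forall s, (exists2 p, path edge s p & cycles_met M (s :: p) = rk s) /\
            (forall p, path edge s p -> cycles_met M (s :: p) <= rk s).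
Proof.
suff /choice[rk hrk] : forall s, exists r,
    (exists2 p, path edge s p & cycles_met M (s :: p) = r) /\
    (forall p, path edge s p -> cycles_met M (s :: p) <= r) by exists rk.
move=> s.
pose P r := `[< exists2 p, path edge s p & cycles_met M (s :: p) = r >].
have exP : exists r, P r.
  by exists (cycles_met M [:: s]); apply/asboolP; exists [::].
have leP r : P r -> r <= #|{set S * X}|.
  by move=> /asboolP[p _ <-]; exact: max_card.
case: (ex_maxnP exP leP) => r /asboolP hr hmax; exists r; split => // p hp.
by apply: hmax; apply/asboolP; exists p.
Qed.

Section Rank.
Variable rk : S -> nat.
Hypothesis rk_attained : forall s,
  exists2 p, path edge s p & cycles_met M (s :: p) = rk s.
Hypothesis rk_max : forall s p, path edge s p -> cycles_met M (s :: p) <= rk s.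

Lemma rank_edge s t : edge s t -> rk t <= rk s.
Proof.
move=> h; have [p hp <-] := rk_attained t.
apply: (@leq_trans (cycles_met M [:: s, t & p])); last first.
  by apply: rk_max; rewrite /= h.
by apply: cycles_met_sub => u hu; rewrite inE hu orbT.
Qed.

Lemma rank_connect s t : connect edge s t -> rk t <= rk s.
Proof.
move=> /connectP[p hp ->]; elim: p s hp => //= u p IH s /andP[h /IH].
by move=> h'; apply: leq_trans h' (rank_edge h).
Qed.

Lemma cyclic_rank_gt0 s : cyclic s -> 0 < rk s.
Proof.
move=> /cyclicP[C hC hs]; apply: (@leq_trans (cycles_met M [:: s])).
  apply/card_gt0P; exists C; apply/cycles_ofP; split => //.
  by exists s => //; exact: mem_head.
exact: (@rk_max s [::]).
Qed.

Lemma trivial_rank s : trivial_state M s -> rk s = 0.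
Proof.
move=> hs; have [p hp <-] := rk_attained s; apply: eq_card0 => C.
apply/negbTE/negP => /cycles_ofP[hC [t ht hCt]].
have : all (pred1 s) p.
  elim: p hp {ht} => //= u p IH /andP[/existsP[x /eqP <-]].
  by rewrite trivial_state_fixed // eqxx.
move=> /allP hall; apply: (nontrivial_cycle_state hC hCt).
by move: ht; rewrite inE => /orP[/eqP ->|/hall /eqP ->].
Qed.

(** Staying on the cycle [C] keeps the rank, since one can return to [s]. After leaving by another
    letter, no path meets [C] again, so starting at [s] gains one more cycle. *)
Lemma cyclic_letter s : cyclic s -> exists x,
  cyclic (trans M s x) /\
  forall y, (rk (trans M s y) == rk s) = (y == x).
Proof.
move=> /[dup] cs /cyclicP[C hC /[dup] hs /on_cycleP[x hx]]; exists x.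
have ht := cycle_trans hC.1 hx.
split; first by apply/cyclicP; exists C.
move=> y; have [->|ne] := eqVneq y x.
  by rewrite eqn_leq !rank_connect // (cycle_connect hC.1).
apply/negbTE; rewrite neq_ltn; apply/orP; left.
have [p hp <-] := rk_attained (trans M s y).
have hsp : path edge s (trans M s y :: p) by rewrite /= edge_trans.
apply: leq_trans (rk_max hsp); apply: proper_card; apply/fintype.properP; split.
  apply/fintype.subsetP => D /cycles_ofP[hD [t ht' hDt]]; apply/cycles_ofP; split => //.
  by exists t => //; rewrite inE ht' orbT.
exists C; first by apply/cycles_ofP; split => //; exists s; rewrite ?mem_head.
apply/negP => /cycles_ofP[_ [t hpt hCt]]; move/eqP: ne; apply.
(* A path back to [C] would close up to a second cycle through [s], which disjointness forbids. *)
have [D hD hDy] : exists2 D, is_cycle M D & (s, y) \in D.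
  apply: connect_cycle; apply: connect_trans (cycle_connect hC.1 hCt hs).
  exact: (path_connect hp).
have hDs : on_cycle D s by apply/on_cycleP; exists y.
have eCD := nontrivial_cycle_uniq (cycle_of_cyclic cs hD hDs) hC hDs hs.
by rewrite eCD in hDy; exact: cycle_arrow_uniq hC.1 hDy hx.
Qed.

Lemma state_at_add i j s w :
  state_at M (i + j) s w = state_at M j (state_at M i s w) (dropn i w).
Proof. by elim: i s w => //= i IH s w; rewrite IH. Qed.

Lemma state_at_connect j s w : connect edge s (state_at M j s w).
Proof.
elim: j s w => //= j IH s w; apply: connect_trans (IH _ _).
exact/connect1/edge_trans.
Qed.

Lemma trivial_state_at j s w : trivial_state M s -> state_at M j s w = s.
Proof. by elim: j s w => //= j IH s w h; rewrite trivial_state_fixed // IH. Qed.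

Lemma cyclic_state_at j s w : cyclic s -> rk (state_at M j s w) = rk s ->
  cyclic (state_at M j s w).
Proof.
elim: j s w => //= j IH s w hs e; have [x [hx hr]] := cyclic_letter hs.
have e' : rk (trans M s (w 0)) = rk s.
  apply/eqP; rewrite eqn_leq rank_edge ?edge_trans // -e.
  by apply: rank_connect; exact: state_at_connect.
apply: IH; last by rewrite e e'.
by move/eqP: e'; rewrite hr => /eqP ->.
Qed.

(* Among the first [#|S| + 1] states visited two are equal. *)
Lemma state_at_recurrent s w : exists i, i <= #|S| /\
  (cyclic (state_at M i s w) \/ trivial_state M (state_at M i s w)).
Proof.
have [i [j [hij hj e]]] : exists i j,
    [/\ i < j, j <= #|S| & state_at M i s w = state_at M j s w].
  pose f (i : 'I_#|S|.+1) := state_at M i s w.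
  have /injectivePn[i [j ne e]] : ~~ injectiveb f.
    by apply/injectiveP => /leq_card; rewrite card_ord ltnn.
  case: (ltngtP i j) => [lt|lt|/val_inj eij]; last by rewrite eij eqxx in ne.
    by exists i, j; split => //; rewrite -ltnS.
  by exists j, i; split => //; rewrite -ltnS.
exists i; split; first exact: leq_trans (ltnW hij) hj.
set t := state_at M i s w; set x := w i.
have [C hC hCx] : exists2 C, is_cycle M C & (t, x) \in C.
  apply: connect_cycle; rewrite {2}/t e -(subnKC hij) addSnnS state_at_add.
  have -> : x = dropn i w 0 by rewrite /dropn addn0.
  exact: (state_at_connect (j - i.+1) (trans M t (dropn i w 0)) (shift (dropn i w))).
have hCt : on_cycle C t by apply/on_cycleP; exists x.
have [[_ [e' [y [he' eC]]]]|hn] := pselect (trivial_cycle M C).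
  by right; move: hCx; rewrite eC inE => /eqP[-> _].
by left; apply/cyclicP; exists C.
Qed.

Lemma rank0_state_at s w : rk s = 0 -> trivial_state M (state_at M #|S| s w).
Proof.
move=> h; have [i [hi [hc|ht]]] := state_at_recurrent s w.
  have := cyclic_rank_gt0 hc; have := rank_connect (state_at_connect i s w); lia.
by rewrite -(subnKC hi) state_at_add trivial_state_at.
Qed.

Lemma rank_state_at_cyclic s w : 0 < rk s -> rk (state_at M #|S| s w) = rk s ->
  cyclic (state_at M #|S| s w).
Proof.
have [i [hi h]] := state_at_recurrent s w.
rewrite -(subnKC hi) state_at_add => s0 e; case: h => [hc|ht]; last first.
  by move: e s0; rewrite trivial_state_at // trivial_rank // => <-.
apply: cyclic_state_at => //; apply/eqP; rewrite eqn_leq.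
rewrite rank_connect ?state_at_connect // e rank_connect //.
exact: state_at_connect.
Qed.

Lemma polynomial_layered : X -> exists xi, layered M rk cyclic xi #|S|.
Proof.
move=> x0; have [xi hxi] : exists xi : S -> X, forall s, cyclic s ->
    cyclic (trans M s (xi s)) /\ forall y, (rk (trans M s y) == rk s) = (y == xi s).
  suff /choice[xi hxi] : forall s, exists x, cyclic s ->
      cyclic (trans M s x) /\
      forall y, (rk (trans M s y) == rk s) = (y == x) by exists xi.
  move=> s; have [/cyclic_letter[x hx]|hs] := pselect (cyclic s); first by exists x.
  (* A default letter at states outside the nontrivial cycles. *)
  by exists x0.
exists xi; split.
- by move=> s x; exact/rank_edge/edge_trans.
- exact: rank0_state_at.
- exact: rank_state_at_cyclic.
- by move=> s /hxi[].
- by move=> s x /hxi[].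
Qed.

End Rank.

End Polynomial.

(** * Words with inverse letters *)

Section Symmetrized.
Variables (X S : finType) (M : automaton X S).
Implicit Types (s : S) (x : X) (w : nat -> X) (q : S * bool).

(* The state [(s, true)] acts as the inverse of [s]. *)
Definition symmetrized : automaton X (S * bool)%type :=
  Automaton
    (fun q x => (trans M q.1 (if q.2 then (out M q.1)^-1%g x else x), q.2))
    (fun q => if q.2 then (out M q.1)^-1%g else out M q.1).

Local Notation M' := symmetrized.

Lemma act_symmetrized s : act M' (s, false) = act M s.
Proof.
apply/funext => w; apply/funext => n.
by elim: n s w => //= n IH s w; rewrite IH.
Qed.

Lemma act_symmetrizedK s : cancel (act M' (s, true)) (act M s).
Proof.
move=> w; apply/funext => n; elim: n s w => [|n IH] s w /=; first by rewrite permKV.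
exact: IH.
Qed.

Lemma act_symmetrizedKV s : cancel (act M s) (act M' (s, true)).
Proof.
move=> w; apply/funext => n; elim: n s w => [|n IH] s w /=; first by rewrite permK.
by rewrite permK; exact: IH.
Qed.

Lemma state_at_symmetrized j q w :
  exists v, state_at M' j q w = (state_at M j q.1 v, q.2).
Proof.
elim: j q w => [|j IH] q w /=; first by exists w; case: q.
have [v ->] := IH (trans M' q (w 0)) (shift w).
by exists (scons (if q.2 then (out M q.1)^-1%g (w 0) else w 0) v).
Qed.

Lemma trivial_symmetrized q : trivial_state M q.1 -> trivial_state M' q.
Proof.
case: q => s [] /= h w; last by rewrite act_symmetrized.
by rewrite -{1}(h w) act_symmetrizedKV.
Qed.

(** Inverse states follow the same arrows with input and output labels exchanged, so the letter
    staying on the cycle becomes the output of [xi]. *)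
Lemma symmetrized_layered rk cyc xi L : layered M rk cyc xi L ->
  layered M' (fun q => rk q.1) (fun q => cyc q.1)
    (fun q => if q.2 then out M q.1 (xi q.1) else xi q.1) L.
Proof.
move=> lay; split.
- by move=> q x; exact: rk_trans lay _ _.
- move=> q w h; have [v ->] := state_at_symmetrized L q w.
  exact/trivial_symmetrized/(rk0_trivial lay).
- move=> q w h; have [v ->] := state_at_symmetrized L q w.
  exact: cyc_state_at lay _ _ h.
- by move=> [s []] /= h; rewrite ?permK; exact: cyc_trans lay _ h.
- move=> [s []] x /= h; rewrite (rk_cyc_trans lay) //.
  by rewrite -(inj_eq (@perm_inj _ (out M s))) permKV.
Qed.

Definition inverse_word (g : seq (S * bool)) : seq (S * bool) :=
  rev [seq (q.1, ~~ q.2) | q <- g].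

Lemma size_inverse_word g : size (inverse_word g) = size g.
Proof. by rewrite size_rev size_map. Qed.

Lemma inverse_wordK : involutive inverse_word.
Proof.
move=> g; rewrite /inverse_word map_rev revK -map_comp map_id_in //.
by move=> [s b] _ /=; rewrite negbK.
Qed.

Lemma wact_inverse_word g : cancel (wact M' g) (wact M' (inverse_word g)).
Proof.
elim: g => [|q g IH] w //.
rewrite /inverse_word map_cons rev_cons -cats1 wact_cat [X in wact _ _ X]IH.
case: q => s [] /=; rewrite act_symmetrized ?act_symmetrizedK //.
exact: act_symmetrizedKV.
Qed.

Lemma automaton_group_word (f : transf X) :
  automaton_group M f -> exists g, f = wact M' g.
Proof.
have sub : automaton_group M `<=` range (wact M').
  apply: smallest_sub => [|_ [s _ <-]]; last first.
    by exists [:: (s, false)] => //; exact: act_symmetrized.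
  split; first by exists [::].
    move=> _ _ [g _ <-] [h _ <-]; exists (h ++ g) => //.
    by apply/funext => w; rewrite wact_cat.
  move=> _ [g _ <-]; exists (wact M' (inverse_word g)).
    by exists (inverse_word g).
  split; first exact: wact_inverse_word.
  by rewrite -{2}(inverse_wordK g); exact: wact_inverse_word.
by move=> /sub [g _ <-]; exists g.
Qed.

(** A step of [graph_ball] from [u] to [v] comes with [f v = u], so the word must lead from [u] back
    to [v]. One length bound serves all generators because [T] is finite. *)
Lemma generators_words (T : set (transf X)) :
  finite_generating_set (automaton_group M) T -> exists2 c, 0 < c &
  forall f, (T `|` inverses T) f -> exists2 g, size g <= c &
  forall u v, f v = u -> wact M' g u = v.
Proof.
move=> [/finite_seqP [l eT] eG].
have hT f : T f -> exists g, f = wact M' g.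
  by move=> hf; apply: automaton_group_word; rewrite -eG; exact: sub_gen_smallest.
have [word hword] : exists word : transf X -> seq (S * bool),
    forall f, T f -> f = wact M' (word f).
  suff /choice[word h] : forall f, exists g, T f -> f = wact M' g by exists word.
  by move=> f; have [/hT[g hg]|] := pselect (T f); [exists g|exists [::]].
exists (\max_(f <- l) size (word f)).+1 => // f.
have hle h : T h -> size (word h) <= (\max_(f <- l) size (word f)).+1.
  by move=> hh; apply: leqW; apply: leq_bigmax_seq => //; rewrite eT in hh.
case=> [hf|[h hh [_ hK]]].
  exists (inverse_word (word f)); first by rewrite size_inverse_word hle.
  by move=> u v <-; rewrite {2}(hword f hf) wact_inverse_word.
exists (word h); first exact: hle.
by move=> u v <-; rewrite -hword.
Qed.

Lemma graph_ball_word (T : set (transf X)) (w : nat -> X) c :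
  (forall f, (T `|` inverses T) f -> exists2 g, size g <= c &
    forall u v, f v = u -> wact M' g u = v) ->
  forall (G : set (transf X)) v n u, graph_ball (schreier G T w) v n u ->
  exists2 g, size g <= c * n & u = wact M' g v.
Proof.
move=> hc G v n u [p [hp hpath <-]].
elim: p v n hp hpath => [|y p IH] v n /=; first by exists [::].
case: n => // n hp /andP[/asboolP[_ _ [f hf e]] /IH].
have [g hg hgv] := hc f hf => /(_ n hp) [h hh ->].
exists (g ++ h); first by rewrite size_cat mulnS leq_add.
by rewrite wact_cat (hgv v y e).
Qed.

End Symmetrized.

(** * Orbits under words of bounded length *)

Section GroupGrowth.
Variables (X S : finType) (M : automaton X S) (k : nat).
Hypotheses (hmin : minimized M) (hpol : polynomial_automaton M).
Hypothesis hdeg : forall p, directed_path M p -> cycles_met M p <= k.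

Lemma covered_group_orbit (x0 : X) : exists2 B, 0 < B & forall n w,
  covered [set z | exists2 g, size g <= n & z = wact (symmetrized M) g w]
    (B ^ (rounds n ^ k)).
Proof.
have [rk hrk] := rank_exists M.
have [xi lay] := polynomial_layered hmin hpol
  (fun s => (hrk s).1) (fun s => (hrk s).2) x0.
have [B B0 hB] := orbit_growth (symmetrized_layered lay) k.
exists B => // n w; apply: covered_sub (leqnn _) (hB n w) => z [g hg ->].
(* All ranks are at most [k], being attained on directed paths. *)
exists g; split => //; apply/allP => q _; rewrite ltnS.
by have [[p hp <-] _] := hrk q.1; apply: hdeg.
Qed.

End GroupGrowth.

Lemma covered_growth (X : finType) (adj : (nat -> X) -> (nat -> X) -> Prop)
    (v : nat -> X) (n N : nat) :
  covered (graph_ball adj v n) N -> growth_function adj v n <= N.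
Proof.
move=> [l hl h].
have fin : finite_set (graph_ball adj v n).
  by apply: sub_finite_set (finite_seq l) => z /h.
apply: leq_trans hl; apply: uniq_leq_size; first exact: fset_uniq.
by move=> z; rewrite in_fset_set // inE => /h.
Qed.

(** * Comparison of growth functions *)

Lemma rounds_log2 (R : realType) n :
  0 < n -> ((rounds n)%:R <= log2 R (4 * n) :> R)%R.
Proof.
move=> n0; rewrite /log2 ifF; last by apply/negbTE; rewrite -ltnNge; lia.
have l2 : (0 < ln 2 :> R)%R by apply: ln_gt0; rewrite ltr1n.
rewrite ler_pdivlMr // mulr_natl -lnXn ?ltr0n // ler_ln ?posrE.
- rewrite -natrX ler_nat expnS; have := trunc_logP (ltnSn 1) (ltn0Sn n); lia.
- by rewrite exprn_gt0.
- by rewrite ltr0n; lia.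
Qed.

(** The square makes [rounds n ^ k] of order at most the square root of [n], hence sublinear.
    Division of [r] by [j] gives [r <= j * 2 ^ (r %/ j)], and the power [j] of this is at most
    [j ^ j * 2 ^ r]. *)
Lemma rounds_expn_sqr k : exists2 D, 0 < D &
  forall n, 0 < n -> (rounds n ^ k) ^ 2 <= D * n.
Proof.
pose j := k.*2.+1; exists (4 * j ^ j); first by rewrite muln_gt0 expn_gt0.
move=> n n0; set r := rounds n.
have hr : r <= j * 2 ^ (r %/ j).
  rewrite {1}(divn_eq r j); have := ltn_expl (r %/ j) (ltnSn 1).
  have : r %% j < j by rewrite ltn_mod.
  nia.
have h2 : 2 ^ r <= 4 * n.
  by rewrite expnS; have := trunc_logP (ltnSn 1) (ltn0Sn n); lia.
rewrite -expnM muln2; apply: (@leq_trans (r ^ j)); first by rewrite leq_pexp2l.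
apply: (@leq_trans (j ^ j * 2 ^ r)); last first.
  by rewrite [4 * _]mulnC -mulnA leq_mul2l h2 orbT.
apply: (@leq_trans ((j * 2 ^ (r %/ j)) ^ j)); first by rewrite leq_exp2r.
by rewrite expnMn -expnM leq_mul // leq_pexp2l // leq_trunc_div.
Qed.

Lemma exists_le_expr (R : realType) (a x : R) :
  (1 < a)%R -> exists p, (x <= a ^+ p)%R.
Proof.
move=> a1; have bern p : (p%:R * (a - 1) <= a ^+ p)%R.
  elim: p => [|p IH]; first by rewrite mul0r expr0.
  have : (1 <= a ^+ p)%R by apply: exprn_ege1; exact: ltW.
  move: IH; rewrite exprS -natr1; nra.
exists (Num.truncn (x / (a - 1))).+1; apply: le_trans (bern _).
rewrite -ler_pdivrMr ?subr_gt0 //; exact/ltW/truncnS_gt.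
Qed.

Lemma subexponential_bound (R : realType) (f : nat -> R) (B c k : nat) :
  0 < B -> 0 < c -> (f 0 <= 1)%R ->
  (forall n, f n <= (B ^ (rounds (c * n) ^ k))%:R)%R -> subexponential f.
Proof.
move=> B0 c0 f0 hf a a1; have [D D0 hD] := rounds_expn_sqr k.
have [p hp] := exists_le_expr (B%:R) a1.
have {}hf n : (f n <= a ^+ (p * rounds (c * n) ^ k))%R.
  apply: le_trans (hf n) _; rewrite natrX exprM lerXn2r // nnegrE ?ler0n //.
  by rewrite exprn_ge0 // ltW // (lt_trans ltr01).
split; [|move=> [_ [C C0 hC]]].
- exists (p * (D * c)).+1 => // -[|n]; first by rewrite muln0 expr0.
  apply: le_trans (hf _) _; rewrite ler_eXn2l //.
  set r := rounds _; have : (r ^ k) ^ 2 <= D * (c * n.+1).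
    by apply: hD; rewrite muln_gt0 c0.
  have : r ^ k <= (r ^ k) ^ 2 by rewrite expnS expn1; nia.
  move=> h1 h2; have := leq_mul (leqnn p) (leq_trans h1 h2); lia.
- pose n := (p ^ 2 * (D * (c * C))).+1.
  have := le_trans (hC n) (hf _); rewrite ler_eXn2l //.
  set r := rounds _; have : (r ^ k) ^ 2 <= D * (c * (C * n)).
    by apply: hD; rewrite !muln_gt0 c0 C0.
  move=> h1 h2; have : n ^ 2 <= n.-1 * n.
    apply: (@leq_trans ((p * r ^ k) ^ 2)); first by rewrite leq_sqr.
    have -> : n.-1 * n = p ^ 2 * (D * (c * (C * n))) by rewrite /= !mulnA.
    by rewrite expnMn leq_mul2l h1 orbT.
  by rewrite expnS expn1 leq_mul2r /= ltnn.
Qed.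

Lemma log_bound (R : realType) (f : nat -> R) (B c k : nat) :
  0 < B -> 0 < c -> (forall n, f n <= (B ^ (rounds (c * n) ^ k))%:R)%R ->
  growth_le f (fun n => (B%:R `^ (log2 R n ^+ k))%R).
Proof.
move=> B0 c0 hf; exists (4 * c) => [|n]; first by rewrite muln_gt0.
apply: le_trans (hf n) _; rewrite natrX -(powR_mulrn (rounds _ ^ k)) ?ler0n //.
apply: ler_powR; first by rewrite ler1n.
(* At 0 both exponents are 1, by the convention for the logarithm. *)
case: n => [|n]; first by rewrite !muln0 /log2 /= expr1n /rounds trunc_log1 exp1n.
rewrite natrX lerXn2r ?nnegrE ?ler0n //.
  apply: le_trans (ler0n R (rounds (c * n.+1))) _.
  by rewrite -mulnA rounds_log2 // muln_gt0 c0.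
by rewrite -mulnA rounds_log2 // muln_gt0 c0.
Qed.

(** * Growth of the orbital Schreier graphs *)

Local Open Scope ring_scope.

Theorem theorem1 (R : realType) (X S : finType) (M : automaton X S) (m : int)
    (hX : (1 < #|X|)%N) (hmin : minimized M)
    (hpol : polynomial_automaton M) (hdeg : has_degree M m) :
  exists2 A : R, 0 < A &
    forall (T : set (transf X)),
      finite_generating_set (automaton_group M) T ->
    forall w v : nat -> X, orbit_of (automaton_group M) w v ->
      let gamma (n : nat) : R :=
        (growth_function (schreier (automaton_group M) T w) v n)%:R in
      subexponential gamma /\
      growth_le gamma (fun n : nat => A `^ (log2 R n ^ (m + 1))).
Proof.
have [[p0 _ e0] hmet] := hdeg; set k := cycles_met M p0 in e0.
have {}hmet p : directed_path M p -> (cycles_met M p <= k)%N.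
  by move=> /hmet; rewrite -e0.
have /card_gt0P[x0 _] : (0 < #|X|)%N := ltnW hX.
have [B B0 hB] := covered_group_orbit hmin hpol hmet x0.
(* The base depends on the automaton only; the generating set enters through [c], which rescales the
   radius. *)
exists B%:R; first by rewrite ltr0n.
move=> T /generators_words[c c0 hc] w v _ gamma.
have hball := graph_ball_word hc (w := w) (G := automaton_group M) (v := v).
have hgamma n : gamma n <= (B ^ (rounds (c * n) ^ k))%:R.
  rewrite ler_nat; apply: covered_growth.
  by apply: covered_sub (leqnn _) (hB (c * n)%N v) => u /hball[g hg ->]; exists g.
split; last by rewrite -e0; exact: log_bound hgamma.
apply: (subexponential_bound B0 c0 _ hgamma).
rewrite (ler_nat R _ 1); apply: covered_growth.
apply: covered_sub (leqnn _) (covered1 v) => u /hball[g].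
by rewrite muln0 leqn0 => /nilP -> ->.
Qed.
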